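(* Let $p\geq 5$ be prime, let $\alpha$ be the smallest positive integer that is a primitive root modulo $p$, and put $c_2=\gcd\{4,p-1\}-1$, $c_3=\gcd\{3,p-1\}-1$. Let $G$ be a group of order $p^5$ generated by $f_1,\dots,f_5$ with $f_5\in Z(G)$, satisfying the commutator relations $[f_2,f_1]=f_3$, $[f_3,f_1]=f_4$, $[f_4,f_1]=[f_3,f_2]=f_5$, $[f_4,f_2]=[f_4,f_3]=1$, and one of the following sets of power relations: (1) $f_i^p=1$ for $1\le i\le 5$ (the group $G(1|p)$); (2) for some $0\le r\le c_2$: $f_1^p=f_5^{\alpha^r}$ and $f_i^p=1$ for $2\le i\le 5$ (the group $G_r(2|p)$); (3) for some $0\le r\le c_3$: $f_2^p=f_5^{\alpha^r}$ and $f_i^p=1$ for $i\in\{1,3,4,5\}$ (the group $G_r(3|p)$). Then $B_0(G)\neq 0$. Since these presentations define $1+c_2+c_3$ pairwise non-isomorphic groups of order $p^5$, there are (at least) $1+\gcd\{4,p-1\}+\gcd\{3,p-1\}$ pairwise non-isomorphic groups $G$ of order $p^5$ with $B_0(G)\neq 0$.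
   Context: $[g,h]=g^{-1}h^{-1}gh$; $Z(G)$ is the center. $B_0(G)=\bigcap_A \ker\{\mathrm{res}^G_A : H^2(G,\mathbb{Q}/\mathbb{Z})\to H^2(A,\mathbb{Q}/\mathbb{Z})\}$, where $A$ runs over all bicyclic subgroups of $G$ (cyclic groups or direct products of two cyclic groups), with trivial action on $\mathbb{Q}/\mathbb{Z}$. By the classification of groups of order $p^5$ (Bender, James), for $p\ge 5$ each of the presentations above (with $f_5$ central) defines a group of order $p^5$, and distinct choices among $G(1|p)$, $G_r(2|p)$ ($0\le r\le c_2$), $G_r(3|p)$ ($0\le r\le c_3$) give non-isomorphic groups. *)

(* Defs.v *)
From HB Require Import structures.
From mathcomp Require Import all_boot all_order all_algebra all_fingroup all_solvable.
Set Implicit Arguments. Unset Strict Implicit. Unset Printing Implicit Defensive.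
Import Order.TTheory GRing.Theory Num.Theory.
Local Open Scope group_scope.

(* Q/Z is modelled by rat modulo the integers: a == b in Q/Z iff a - b is an integer. *)
Definition qz_eq (a b : rat) : bool := ((a - b)%R \is a Num.int).

(* Normalized-free inhomogeneous 2-cocycles G x G -> Q/Z with trivial action:
   (delta f)(x,y,z) = f(y,z) - f(xy,z) + f(x,yz) - f(x,y) = 0 in Q/Z. *)
Definition cocycle2 (gT : finGroupType) (G : {set gT}) (f : gT -> gT -> rat) : Prop :=
  forall x y z, x \in G -> y \in G -> z \in G ->
    qz_eq (f y z - f (mulg x y) z + f x (mulg y z) - f x y)%R 0.

Definition coboundary2 (gT : finGroupType) (A : {set gT}) (f : gT -> gT -> rat) : Prop :=
  exists g : gT -> rat, forall x y, x \in A -> y \in A ->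
    qz_eq (f x y) (g x + g y - g (mulg x y))%R.

Definition bicyclic (gT : finGroupType) (A : {group gT}) : Prop :=
  cyclic A \/ exists H K : {group gT}, [/\ cyclic H, cyclic K & H \x K = A].

Definition B0_nontrivial (gT : finGroupType) (G : {group gT}) : Prop :=
  exists f : gT -> gT -> rat,
    [/\ cocycle2 G f, ~ coboundary2 G f &
        forall A : {group gT}, A \subset G -> bicyclic A -> coboundary2 A f].

Definition prim_root_mod (p a : nat) : bool :=
  coprime a p && [forall k : 'I_p.-1, (0 < k)%N ==> (a ^ k %% p != 1 %% p)%N].

(* Main.v *)
Require Import Defs.
From HB Require Import structures.
From mathcomp Require Import all_boot all_order all_algebra all_fingroup all_solvable.
From mathcomp Require Import ring.
Import GRing.Theory Num.Theory.
Local Open Scope group_scope.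

(* [G] modulo [<[f4]> * <[f5]>] is the Heisenberg group of order p^3, and the nonzero class of B0
   is inflated from it: it is the class of the extension of that group by a central f6 with
   [f3, f2] = f6 and [f3, f1] = 1. Pulled back to [G] it separates the two commutators
   [f4, f1] = [f3, f2], so it does not split. In logarithmic coordinates on the Heisenberg quotient
   the Baker-Campbell-Hausdorff formula gives a cocycle which vanishes on proportional vectors, and
   commuting elements of [G] have proportional coordinates; hence it vanishes identically on every
   abelian subgroup.

   The groups themselves are realised on 'F_p^5 by the Baker-Campbell-Hausdorff formula of class 4,
   twisted by carries that make the p-th powers of the generators nontrivial. Comparing p-th powers
   under an isomorphism multiplies the exponents by fourth, respectively third, powers in 'F_p. *)

(** * Arithmetic of ['F_p] inside Q/Z, and commutation lemmas *)

Lemma natF_eqP (p m n : nat) : prime p ->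
  ((m%:R : 'F_p) == n%:R)%R = (m == n %[mod p]).
Proof. by move=> pp; rewrite -val_eqE /= !val_Fp_nat. Qed.

(** Division by [p] embeds ['F_p] in Q/Z, so congruences between values of an ['F_p]-valued cochain
    become polynomial identities within reach of [ring]. *)
Lemma qz_natF (p m n : nat) : prime p ->
  qz_eq (m%:R / p%:R)%R (n%:R / p%:R)%R = ((m%:R : 'F_p) == n%:R)%R.
Proof.
move=> pp; have p0 : (p%:R != 0 :> rat)%R by rewrite pnatr_eq0 -lt0n prime_gt0.
rewrite /qz_eq -mulrBl; apply/idP/eqP.
  move=> /intrP [z /(congr1 ( *%R^~ p%:R)%R)]; rewrite divfK // => E.
  have {}E : (m%:Z - n%:Z = z * p%:Z)%R.
    by apply/eqP; rewrite -(eqr_int rat) rmorphB rmorphM /= E.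
  apply/eqP; rewrite -subr_eq0 -[(_ - _)%R]/(m%:Z%:~R - n%:Z%:~R)%R -rmorphB E rmorphM /=.
  by rewrite -[(p%:~R)%R]/(p%:R)%R pchar_Fp_0 // mulr0.
move/eqP; rewrite natF_eqP // => /eqP E.
rewrite (divn_eq m p) (divn_eq n p) E !natrD !natrM opprD addrACA subrr addr0 -mulrBl mulfK //.
by rewrite rpredB // natr_int.
Qed.

(** The integers to be inverted below (2, 12, 24) have no prime factor above 3; the condition on
    [primes n] is then closed by computation. *)
Lemma natF_neq0 (p n : nat) : prime p -> (5 <= p)%N ->
  (0 < n)%N -> all (fun q => q < 5)%N (primes n) -> (n%:R != 0 :> 'F_p)%R.
Proof.
move=> pp p5 n0 /allP lt5; rewrite -(dvdn_pcharf (pchar_Fp pp)); apply/negP => pn.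
by have := lt5 p; rewrite mem_primes pp n0 pn ltnNge p5 => /(_ isT).
Qed.

Lemma expgFp (p n : nat) (gT : finGroupType) (x : gT) : prime p ->
  x ^+ p = 1 -> x ^+ (n%:R : 'F_p)%R = x ^+ n.
Proof. by move=> pp xp; rewrite val_Fp_nat // expg_mod. Qed.

(** Collection in a group of Heisenberg type. It serves the images of [f1], [f2], [f3] modulo [f4]
    and [f5], and also the triple [f2], [f3], [f5]. *)
Lemma heis_mulg (gT : finGroupType) (x y z : gT) (a b c a' b' c' : nat) :
  [~ y, x] = z -> commute x z -> commute y z ->
  x ^+ a * y ^+ b * z ^+ c * (x ^+ a' * y ^+ b' * z ^+ c') =
  x ^+ (a + a') * y ^+ (b + b') * z ^+ (c + c' + b * a').
Proof.
move=> yx xz yz.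
have E : y ^+ b * x ^+ a' = x ^+ a' * y ^+ b * z ^+ (b * a').
  by rewrite commgC commXXg yx.
have zx i j : z ^+ i * x ^+ j = x ^+ j * z ^+ i by apply: commuteX2; apply: commute_sym.
have zy i j : z ^+ i * y ^+ j = y ^+ j * z ^+ i by apply: commuteX2; apply: commute_sym.
rewrite !expgD -!mulgA; congr (_ * _); rewrite (mulgA (z ^+ c)) zx -!mulgA (mulgA (y ^+ b)) E.
rewrite -!mulgA; do 2![congr (_ * _)].
rewrite [z ^+ (b * a') * _]mulgA -!expgD mulgA zy -mulgA -!expgD; congr (_ * _ ^+ _).
by rewrite addnA addnC addnA addnC addnA.
Qed.

(** By coprimality [x ^+ n] generates [<[x]>], so both elements have the same centraliser. *)
Lemma commute_of_expg (gT : finGroupType) (p n : nat) (x y : gT) :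
  x ^+ p = 1 -> coprime p n -> commute (x ^+ n) y -> commute x y.
Proof.
move=> xp pn xny; have /eqP xE : generator <[x]> (x ^+ n).
  have xdp : (#[x] %| p)%N by rewrite order_dvdn xp.
  by rewrite generator_coprime (coprime_dvdl xdp).
suff: <[x]> \subset 'C[y] by rewrite cycle_subG => /cent1P/commute_sym.
by rewrite xE cycle_subG; apply/cent1P/commute_sym.
Qed.

(** * Nontriviality of B0 from the commutator and power relations *)

Section Presentation.
Variables (p : nat) (gT : finGroupType) (G : {group gT}) (f1 f2 f3 f4 f5 : gT).
Hypotheses (pp : prime p) (p5 : (5 <= p)%N) (oG : #|G| = (p ^ 5)%N).
Hypotheses (genG : G :=: <<[set f1; f2; f3; f4; f5]>>) (Zf5 : f5 \in 'Z(G)).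
Hypotheses (r21 : [~ f2, f1] = f3) (r31 : [~ f3, f1] = f4) (r41 : [~ f4, f1] = f5).
Hypotheses (r32 : [~ f3, f2] = f5) (r42 : [~ f4, f2] = 1) (r43 : [~ f4, f3] = 1).
Hypotheses (f1p : f1 ^+ p \in <[f5]>) (f2p : f2 ^+ p \in <[f5]>).
Hypotheses (f3p : f3 ^+ p = 1) (f4p : f4 ^+ p = 1) (f5p : f5 ^+ p = 1).

Let N := <<[set f4; f5]>>.

Let Gf : [/\ f1 \in G, f2 \in G, f3 \in G, f4 \in G & f5 \in G].
Proof. by rewrite genG; split; apply: mem_gen; rewrite !inE eqxx ?orbT. Qed.

Let cf5 x : x \in G -> commute f5 x.
Proof. by case/centerP: Zf5 => _; apply. Qed.

Let norm_of (H : {set gT}) :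
  [/\ f1 \in 'N(H), f2 \in 'N(H), f3 \in 'N(H), f4 \in 'N(H) & f5 \in 'N(H)] -> G \subset 'N(H).
Proof.
case=> *; rewrite genG gen_subG; apply/subsetP => x; rewrite !in_setU !in_set1 -!orbA.
by case/or4P => [||| /orP[]] /eqP ->; assumption.
Qed.

Let nG5 : G \subset 'N(<[f5]>).
Proof. by apply/cents_norm; rewrite centsC cycle_subG; case/setIP: Zf5. Qed.

Let f5N : f5 \in N. Proof. by rewrite mem_gen // !inE eqxx orbT. Qed.
Let f4N : f4 \in N. Proof. by rewrite mem_gen // !inE eqxx. Qed.

Let nGN : G \subset 'N(N).
Proof.
have [F1 F2 F3 F4 F5] := Gf.
have nN x : x \in G -> [~ f4, x] \in N -> x \in 'N(N).
  move=> xG f4x; rewrite inE -genJ gen_subG conjUg !conjg_set1 subUset !sub1set.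
  rewrite !conjg_mulR groupM //=.
  by rewrite (_ : [~ f5, x] = 1) ?mulg1 //; apply/eqP/commgP/cf5.
apply: norm_of; split; apply: nN => //.
- by rewrite r41.
- by rewrite r42 group1.
- by rewrite r43 group1.
- by rewrite commgg group1.
- by rewrite (_ : [~ f4, f5] = 1) ?group1 //; apply/eqP/commgP/commute_sym/cf5.
Qed.

Let NG : N \subset G.
Proof. by rewrite gen_subG subUset !sub1set; case: Gf => _ _ _ -> ->. Qed.

Let NE : N = <[f4]> * <[f5]>.
Proof.
have -> : N = <[f4]> <*> <[f5]> by rewrite joing_idl joing_idr.
rewrite cent_joinEr // cycle_subG; apply/centP => x /cycleP[i ->].
by apply/commuteX/cf5; case: Gf.
Qed.

Let order_le (x : gT) : x ^+ p = 1 -> (#[x] <= p)%N.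
Proof. by move=> xp; rewrite dvdn_leq ?prime_gt0 // order_dvdn xp. Qed.

Let oN : (#|N| <= p ^ 2)%N.
Proof.
rewrite -mulnn; apply: (leq_trans _ (leq_mul (order_le _ f4p) (order_le _ f5p))).
by rewrite NE mul_cardG leq_pmulr ?cardG_gt0.
Qed.

(** * Normal forms modulo [N] *)

Let phi (u : 'F_p * 'F_p * 'F_p) : coset_of N :=
  coset N f1 ^+ u.1.1 * coset N f2 ^+ u.1.2 * coset N f3 ^+ u.2.

Let cosetN_expg x (n : nat) : x \in G -> coset N x ^+ n = coset N (x ^+ n).
Proof. by move=> xG; rewrite morphX ?(subsetP nGN). Qed.

Let g1p : coset N f1 ^+ p = 1.
Proof.
have [F1 F2 F3 F4 F5] := Gf; rewrite cosetN_expg // coset_id //.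
by apply: subsetP f1p; rewrite cycle_subG.
Qed.
Let g2p : coset N f2 ^+ p = 1.
Proof.
have [F1 F2 F3 F4 F5] := Gf; rewrite cosetN_expg // coset_id //.
by apply: subsetP f2p; rewrite cycle_subG.
Qed.
Let g3p : coset N f3 ^+ p = 1.
Proof. by have [F1 F2 F3 F4 F5] := Gf; rewrite cosetN_expg // f3p coset_id // group1. Qed.

Let phiE (a b c : nat) :
  phi (a%:R, b%:R, c%:R)%R = coset N f1 ^+ a * coset N f2 ^+ b * coset N f3 ^+ c.
Proof. by rewrite /phi /= !expgFp. Qed.

Let cosetN_comm x y : x \in G -> y \in G -> [~ x, y] \in N -> commute (coset N x) (coset N y).
Proof.
move=> xG yG xyN; apply/commgP; rewrite -morphR ?(subsetP nGN) //=.
by rewrite coset_id.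
Qed.

Let heis_op (u v : 'F_p * 'F_p * 'F_p) : 'F_p * 'F_p * 'F_p :=
  (u.1.1 + v.1.1, u.1.2 + v.1.2, u.2 + v.2 + u.1.2 * v.1.1)%R.

Let natE (t : 'F_p) : exists n : nat, t = n%:R%R.
Proof. by exists t; rewrite natr_Zp. Qed.

Let phiM u v : phi u * phi v = phi (heis_op u v).
Proof.
have [F1 F2 F3 F4 F5] := Gf.
case: u v => [[a b] c] [[a' b'] c']; rewrite /heis_op /=.
have [[na ->] [nb ->] [nc ->]] := And3 (natE a) (natE b) (natE c).
have [[na' ->] [nb' ->] [nc' ->]] := And3 (natE a') (natE b') (natE c').
rewrite -natrM -!natrD !phiE; apply: heis_mulg.
- by rewrite -morphR ?(subsetP nGN) //= r21.
- by apply: cosetN_comm => //; rewrite -groupV invg_comm r31.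
- by apply: cosetN_comm => //; rewrite -groupV invg_comm r32.
Qed.

Let phi_gen : phi (1, 0, 0)%R = coset N f1 /\ phi (0, 1, 0)%R = coset N f2 /\
  phi (0, 0, 1)%R = coset N f3 /\ phi (0, 0, 0)%R = 1.
Proof. by rewrite -[0%R]/(0%:R)%R -[1%R]/(1%:R)%R !phiE !expg0 !expg1 !mulg1 !mul1g. Qed.

Let phi_onto : G / N \subset [set phi u | u in [set: 'F_p * 'F_p * 'F_p]].
Proof.
have [E1 [E2 [E3 E0]]] := phi_gen.
have gS : group_set [set phi u | u in [set: 'F_p * 'F_p * 'F_p]].
  apply/group_setP; split; first by rewrite -E0 imset_f.
  by move=> _ _ /imsetP[u _ ->] /imsetP[v _ ->]; rewrite phiM imset_f.
have [F1 F2 F3 F4 F5] := Gf.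
rewrite genG quotient_gen; last by rewrite -gen_subG -genG.
rewrite (_ : [set phi u | u in _] = Group gS) // gen_subG; apply/subsetP => _ /morphimP[x _ xf ->].
move: xf; rewrite !in_setU !in_set1 -!orbA; case/or4P => [||| /orP[]] /eqP ->.
- by rewrite /= -E1 imset_f.
- by rewrite /= -E2 imset_f.
- by rewrite /= -E3 imset_f.
- by rewrite /= coset_id // -E0 imset_f.
- by rewrite /= coset_id // -E0 imset_f.
Qed.

Let card_triples : #|[set: 'F_p * 'F_p * 'F_p]| = (p ^ 3)%N.
Proof. by rewrite cardsT !card_prod !card_Fp // !expnSr expn0 mul1n. Qed.

(** [N] has at most p^2 elements, and the at most p^3 normal forms cover [G / N]. As [G] has order
    p^5, both bounds are attained. *)
Let card_imphi : #|[set phi u | u in [set: 'F_p * 'F_p * 'F_p]]| = (p ^ 3)%N /\ (p ^ 2 <= #|N|)%N.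
Proof.
have p0 n : (0 < p ^ n)%N by rewrite expn_gt0 prime_gt0.
have oGN : (#|N| * #|G / N| = p ^ 5)%N by rewrite card_quotient // Lagrange.
have le1 := subset_leq_card phi_onto.
have le2 : (#|[set phi u | u in [set: 'F_p * 'F_p * 'F_p]]| <= p ^ 3)%N.
  by rewrite -card_triples leq_imset_card.
split.
  apply/eqP; rewrite eqn_leq le2 /=; apply: (leq_trans _ le1).
  by rewrite -(leq_pmul2l (p0 2)) -expnD -oGN leq_mul2r oN orbT.
by rewrite -(leq_pmul2r (p0 3)) -expnD -oGN leq_mul2l (leq_trans le1 le2) orbT.
Qed.

Let phi_inj : injective phi.
Proof.
have [E _] := card_imphi; move/eqP: E; rewrite -card_triples => /imset_injP inj.
by move=> u v; apply: inj; rewrite inE.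
Qed.

(** This lower bound on [N] shows that [f4] is not a power of [f5], and that [f5] is nontrivial. *)
Let oN_gt (x : gT) : x ^+ p = 1 -> N <> <[x]>.
Proof.
have [_ leN] := card_imphi; move=> /order_le x_le /(congr1 (fun A : {set gT} => #|A|)) NEx.
have := leq_trans leN (leq_trans (eq_leq NEx) x_le).
by rewrite -mulnn leqNgt ltn_Pmull ?prime_gt1 ?prime_gt0.
Qed.

Let f4_notin : f4 \notin <[f5]>.
Proof.
apply/negP => f45; apply: (oN_gt _ f5p); apply/eqP.
by rewrite eqEsubset cycle_subG f5N gen_subG subUset !sub1set f45 cycle_id.
Qed.

Let of5 : #[f5] = p.
Proof.
have : (#[f5] %| p)%N by rewrite order_dvdn f5p.
case/primeP: (pp) => _ H /H /orP[|] /eqP // /eqP; rewrite order_eq1 => /eqP f51.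
by case: (oN_gt _ f4p); rewrite NE f51 cycle1 mulg1.
Qed.

(** The normal-form coordinates of [x] modulo [N]. On [G] the default is never reached, because of
    [phi_onto]. *)
Let psi x : 'F_p * 'F_p * 'F_p := odflt (0, 0, 0)%R [pick u | phi u == coset N x].

Let psiK x : x \in G -> phi (psi x) = coset N x.
Proof.
move=> xG; rewrite /psi; case: pickP => [u /eqP //|no].
have /(subsetP phi_onto)/imsetP[u _ E] : coset N x \in G / N by rewrite mem_quotient.
by have := no u; rewrite E eqxx.
Qed.

Let psiE x u : x \in G -> coset N x = phi u -> psi x = u.
Proof. by move=> xG xu; apply: phi_inj; rewrite psiK. Qed.

Let psiM x y : x \in G -> y \in G -> psi (x * y) = heis_op (psi x) (psi y).
Proof.
by move=> xG yG; apply: psiE; rewrite ?groupM // -phiM !psiK // morphM ?(subsetP nGN).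
Qed.

Let psi_decomp x (a b c : nat) : x \in G -> psi x = (a%:R, b%:R, c%:R)%R ->
  exists2 n, n \in N & x = n * (f1 ^+ a * f2 ^+ b * f3 ^+ c).
Proof.
have [F1 F2 F3 F4 F5] := Gf.
move=> xG xE; have := psiK _ xG; rewrite xE phiE !cosetN_expg // => E.
have yG : f1 ^+ a * f2 ^+ b * f3 ^+ c \in G by rewrite !groupM ?groupX.
have /esym/rcoset_kercosetP : coset N (f1 ^+ a * f2 ^+ b * f3 ^+ c) = coset N x.
  by rewrite -E !morphM ?groupM ?groupX ?(subsetP nGN).
by rewrite !(subsetP nGN) // => /(_ isT isT) /rcosetP[n nN ->]; exists n.
Qed.

Let psi_N x : x \in N -> psi x = (0, 0, 0)%R.
Proof.
move=> xN; apply: psiE; first exact: subsetP xN.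
by rewrite coset_id //; have [_ [_ [_ ->]]] := phi_gen.
Qed.

Let psi_normal_form x : x \in G -> exists a b c : nat,
  psi x = (a%:R, b%:R, c%:R)%R /\
  exists2 n, n \in N & x = n * (f1 ^+ a * f2 ^+ b * f3 ^+ c).
Proof.
move=> xG; case E: (psi x) => [[u v] t].
have [[a aE] [b bE] [c cE]] := And3 (natE u) (natE v) (natE t).
exists a, b, c; rewrite -aE -bE -cE; split=> //.
by apply: psi_decomp; rewrite // E aE bE cE.
Qed.

(* The centraliser of [f3] modulo [<[f5]>] contains [f2], [f3], [f4], [f5] but not [f1], since
   [f3, f1] = f4. *)
Let psi_cent x z : x \in G -> z \in G -> commute x z ->
  (psi x).1.1 != 0%R -> (psi z).1 = (0, 0)%R -> (psi z).2 = 0%R.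
Proof.
have [F1 F2 F3 F4 F5] := Gf; have n5 y : y \in G -> y \in 'N(<[f5]>) := subsetP nG5 y.
(* If the [f3]-exponent of [z] were nonzero, [f3] would commute with [x], and then with [f1], modulo
   [<[f5]>]; this would put [f4] in [<[f5]>]. *)
move=> xG zG xz xa za; apply/eqP; case: (boolP (_ == _)) => // zc; case/negP: f4_notin.
have [a [b [c [xE [m mN xm]]]]] := psi_normal_form _ xG.
have [a' [b' [c' [zE _]]]] := psi_normal_form _ zG.
have [n nN zn] : exists2 n, n \in N & z = n * f3 ^+ c'.
  have [] := psi_decomp _ 0 0 c' zG; last by move=> n nN ->; exists n; rewrite // !expg0 !mul1g.
  by rewrite zE; move: za; rewrite zE /= => ->.
pose q := coset <[f5]>.
have qX y i : y \in G -> q (y ^+ i) = q y ^+ i by move=> yG; rewrite /q morphX ?n5.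
have qM y1 y2 : y1 \in G -> y2 \in G -> q (y1 * y2) = q y1 * q y2.
  by move=> y1G y2G; rewrite /q morphM ?n5.
have q1 y : y \in <[f5]> -> q y = 1 by exact: coset_id.
have qcomm y1 y2 : y1 \in G -> y2 \in G -> [~ y1, y2] \in <[f5]> -> commute (q y1) (q y2).
  by move=> y1G y2G y12; apply/commgP; rewrite -morphR ?n5 //= coset_id.
have cN y k : y \in G -> k \in N -> [~ f4, y] \in <[f5]> -> commute (q k) (q y).
  move=> yG; rewrite NE => /mulsgP[_ u /cycleP[i ->] u5 ->] f4y.
  have uG : u \in G by apply: subsetP u5; rewrite cycle_subG.
  rewrite qM ?groupX // (q1 u) // mulg1 qX //; apply/commute_sym/commuteX/commute_sym.
  exact: qcomm.
have [r4 r5] : [~ f4, f2] \in <[f5]> /\ [~ f4, f3] \in <[f5]> by rewrite r42 r43 group1.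
have r6 : [~ f4, f1] \in <[f5]> by rewrite r41 cycle_id.
have [mG nG] : m \in G /\ n \in G by split; apply: (subsetP NG).
have qxn : commute (q x) (q n).
  apply/commute_sym; rewrite xm !qM ?groupM ?groupX // !qX //.
  apply: commuteM; last by do ![apply: commuteM]; apply: commuteX; apply: cN.
  move: (mN); rewrite NE => /mulsgP[_ u /cycleP[i ->] u5 ->].
  have uG : u \in G by apply: subsetP u5; rewrite cycle_subG.
  rewrite qM ?groupX // (q1 u) // mulg1 qX //; apply: commuteX; apply: cN => //.
  by rewrite commgg group1.
have cop t : (t%:R != 0 :> 'F_p)%R -> coprime p t.
  by rewrite -(dvdn_pcharf (pchar_Fp pp)) prime_coprime.
have qxf3 : commute (q f3) (q x).
  apply: (@commute_of_expg _ p c'); first by rewrite -qX // f3p q1 ?group1.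
    by apply: cop; move: zc; rewrite zE.
  apply/commute_sym; have : commute (q x) (q n * q f3 ^+ c').
    by rewrite -qX // -qM ?groupX // -zn /commute -!qM // xz.
  move=> H; rewrite -[_ ^+ _](mulKg (q n)); apply: commuteM => //; exact: commuteV.
have qf1f3 : commute (q f1) (q f3).
  apply: (@commute_of_expg _ p a); first by rewrite -qX // q1.
    by apply: cop; move: xa; rewrite xE.
  have : q m * (q f1 ^+ a * q f2 ^+ b * q f3 ^+ c) \in 'C[q f3].
    by rewrite -!qX // -!qM ?groupM ?groupX // -xm; apply/cent1P/commute_sym.
  have Cm : q m \in 'C[q f3] by apply/cent1P; apply: cN.
  have C2 : q f2 ^+ b \in 'C[q f3].
    by apply/groupX/cent1P/commute_sym/qcomm => //; rewrite r32 cycle_id.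
  have C3 : q f3 ^+ c \in 'C[q f3] by apply/groupX/cent1P.
  by rewrite groupMl // groupMr // groupMr // => /cent1P.
rewrite -r31; apply: coset_idr; first by rewrite n5 ?groupR.
by rewrite morphR ?n5 //; apply/eqP/commgP/commute_sym.
Qed.

(** * Logarithmic coordinates and commuting pairs *)

Let cA x : 'F_p := (psi x).1.1.
Let cB x : 'F_p := (psi x).1.2.
(* Twice the f3-coordinate of the logarithm of f1^a f2^b f3^c, which is c - a b / 2. *)
Let cC x : 'F_p := (2 * (psi x).2 - cA x * cB x)%R.

(** In logarithmic form the cross term is alternating: it vanishes on powers of one element, and
    [cC] differs on [x * y] and [y * x] by twice this term. *)
Let coordsM x y : x \in G -> y \in G -> [/\ cA (x * y)%g = cA x + cA y, cB (x * y)%g = cB x + cB y &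
  cC (x * y)%g = cC x + cC y + (cB x * cA y - cA x * cB y)]%R.
Proof. by move=> xG yG; rewrite /cC /cA /cB psiM //=; split=> //; ring. Qed.

Let coordsX x n : x \in G ->
  [/\ cA (x ^+ n)%g = cA x *+ n, cB (x ^+ n)%g = cB x *+ n & cC (x ^+ n)%g = cC x *+ n]%R.
Proof.
move=> xG; elim: n => [|n [IA IB IC]].
  by rewrite expg0 /cC /cA /cB psi_N ?group1 //=; split=> //; ring.
rewrite expgS; have [-> -> ->] := coordsM _ _ xG (groupX n xG).
by rewrite IA IB IC !mulrSr; split; ring.
Qed.

Let nat2_neq0 : (2%:R != 0 :> 'F_p)%R. Proof. exact: natF_neq0. Qed.

Let coords_wedge0 x y : x \in G -> y \in G -> commute x y -> (cB x * cA y - cA x * cB y = 0)%R.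
Proof.
move=> xG yG xy; have [_ _ Cxy] := coordsM _ _ xG yG; have [_ _ Cyx] := coordsM _ _ yG xG.
apply/eqP; rewrite -(mulrI_eq0 _ (mulfI nat2_neq0)).
have -> : (2 * (cB x * cA y - cA x * cB y) = cC (x * y)%g - cC (y * x)%g)%R.
  by rewrite Cxy Cyx; ring.
by rewrite xy subrr.
Qed.

(** Divide [y] by the power of [x] with the same [f1]-exponent. The wedge relation kills the
    [f2]-exponent of the quotient and [psi_cent] its [f3]-exponent, so the coordinates of [y] are
    proportional to those of [x]. *)
Let coords_comm_aux x y : x \in G -> y \in G -> commute x y -> cA x != 0%R ->
  (cC x * cB y = cB x * cC y)%R.
Proof.
move=> xG yG xy xa.
have w0 : (cB x * cA y = cA x * cB y)%R by apply/eqP; rewrite -subr_eq0 coords_wedge0.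
have [n nE] := natE (cA y / cA x)%R.
have {nE}Ay : (cA y = cA x *+ n)%R by rewrite -mulr_natr -nE mulrC divfK.
have [XA XB XC] := coordsX x n xG; pose z := (x ^+ n)%g^-1 * y.
have zG : z \in G by rewrite groupM ?groupV ?groupX.
have yE : y = x ^+ n * z by rewrite mulKVg.
have [YA YB YC] := coordsM _ _ (groupX n xG) zG; rewrite -yE in YA YB YC.
have By : (cB y = cB x *+ n)%R.
  by apply: (mulfI xa); rewrite -w0 Ay mulrnAr mulrnAr mulrC.
have zA : cA z = 0%R by move: YA; rewrite XA Ay -[LHS]addr0 => /addrI.
have zB : cB z = 0%R by move: YB; rewrite XB By -[LHS]addr0 => /addrI.
have xz : commute x z by apply: commuteM => //; apply/commuteV/commuteX.
have zc : (psi z).2 = 0%R.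
  apply: (psi_cent _ _ xG zG xz xa); move: zA zB; rewrite /cA /cB.
  by case: (psi z) => [[u v] t] /= -> ->.
have zC : cC z = 0%R by rewrite /cC zA zB zc; ring.
by rewrite YC XC XA XB zA zB zC By !mulr0 subrr !addr0 mulrnAr mulrnAr mulrC.
Qed.

Let coords_comm x y : x \in G -> y \in G -> commute x y ->
  (cB x * cA y - cA x * cB y = 0 /\ cC x * cB y - cB x * cC y = 0)%R.
Proof.
move=> xG yG xy; split; first exact: coords_wedge0.
apply/eqP; rewrite subr_eq0; apply/eqP.
have [xA|xA] := eqVneq (cA x) 0%R; last exact: coords_comm_aux.
have [yA|yA] := eqVneq (cA y) 0%R; last first.
  by rewrite mulrC -(coords_comm_aux y x) // mulrC.
(* Now [x] and [y] are elements of [N] times words in [f2] and [f3]. Since [N] is abelian and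
   commutes with [f2] and [f3], the two words commute, and comparing their powers of [f5] gives the
   claim. *)
have [F1 F2 F3 F4 F5] := Gf.
have [a [b [c [xE _]]]] := psi_normal_form _ xG.
have [a' [b' [c' [yE _]]]] := psi_normal_form _ yG.
have [n nN xn] : exists2 n, n \in N & x = n * (f2 ^+ b * f3 ^+ c).
  have [] := psi_decomp _ 0 b c xG; last by move=> n nN ->; exists n; rewrite // !expg0 !mul1g.
  by rewrite xE; move: xA; rewrite /cA xE /= => ->.
have [n' nN' yn] : exists2 n, n \in N & y = n * (f2 ^+ b' * f3 ^+ c').
  have [] := psi_decomp _ 0 b' c' yG; last by move=> m mN ->; exists m; rewrite // !expg0 !mul1g.
  by rewrite yE; move: yA; rewrite /cA yE /= => ->.
have Ncomm m k : m \in N -> k \in N \/ k = f2 \/ k = f3 -> commute m k.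
  have cfN j : j \in N -> commute f4 j.
    rewrite NE => /mulsgP[_ u /cycleP[i ->] /cycleP[i' ->] ->].
    by apply: commuteM; apply: commuteX => //; apply/commute_sym/cf5.
  rewrite {1}NE => /mulsgP[_ u /cycleP[i ->] /cycleP[i' ->] ->] H.
  have kG : k \in G by case: H => [/(subsetP NG)|[|]-> ].
  apply/commute_sym/commuteM; apply/commuteX/commute_sym; last exact: cf5.
  by case: H => [/cfN|[|]->] //; apply/commgP; rewrite ?r42 ?r43.
pose u := f2 ^+ b * f3 ^+ c; pose v := f2 ^+ b' * f3 ^+ c'.
have Nu m : m \in N -> commute m u.
  by move=> mN; apply: commuteM; apply: commuteX; apply: Ncomm; rewrite //; right; [left|right].
have Nv m : m \in N -> commute m v.
  by move=> mN; apply: commuteM; apply: commuteX; apply: Ncomm; rewrite //; right; [left|right].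
have uv : u * v = v * u.
  have cancel m m' (w t : gT) : commute m m' -> commute m' w -> commute m t ->
      commute (m * w) (m' * t) -> w * t = t * w.
    move=> mm' m'w mt H; apply: (mulgI (m * m')).
    have <- : m * w * (m' * t) = m * m' * (w * t) by rewrite -!mulgA (mulgA w) -m'w !mulgA.
    by rewrite [LHS]H mm' -!mulgA; congr (_ * _); rewrite !mulgA mt.
  apply: (cancel n n'); rewrite -?xn -?yn //; [| exact: Nu | exact: Nv].
  by apply: Ncomm => //; left.
have E i j k l :
    f2 ^+ i * f3 ^+ j * (f2 ^+ k * f3 ^+ l) = f2 ^+ (i + k) * f3 ^+ (j + l) * f5 ^+ (j * k).
  have := heis_mulg _ f2 f3 f5 i j 0 k l 0 r32 (commute_sym (cf5 _ F2)) (commute_sym (cf5 _ F3)).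
  by rewrite !expg0 !mulg1.
have : f5 ^+ (c * b') == f5 ^+ (c' * b).
  move: uv; rewrite /u /v !E [(b' + b)%N]addnC [(c' + c)%N]addnC => /mulgI H; exact/eqP.
rewrite eq_expg_mod_order of5 -natF_eqP // !natrM => /eqP E5.
by rewrite /cC xA yA /cB xE yE /= !mul0r !subr0 -mulrA E5; ring.
Qed.

(* The f6-component of the Baker-Campbell-Hausdorff series, rescaled to clear denominators. *)
Let F x y : 'F_p :=
  (3 * (cC x * cB y - cB x * cC y) - (cB x - cB y) * (cB x * cA y - cA x * cB y))%R.

Let f x y : rat := ((F x y : nat)%:R / p%:R)%R.

Let FN x y : x \in N -> F x y = 0%R /\ F y x = 0%R.
Proof. by move=> xN; rewrite /F /cC /cA /cB psi_N //=; split; ring. Qed.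

Let f0 x y : F x y = 0%R -> f x y = 0%R.
Proof. by rewrite /f => ->; rewrite mul0r. Qed.

Let f_cocycle : cocycle2 G f.
Proof.
move=> x y z xG yG zG; rewrite /f -mulrBl -mulrDl -mulrBl.
set Fyz := F y z; set Fxyz := F _ z; set Fx_yz := F x _; set Fxy := F x y.
rewrite /qz_eq subr0.
(* Negative terms move to the other side, so that each side is a natural number over [p], the form
   compared by [qz_natF]. *)
have -> : ((Fyz%:R - Fxyz%:R + Fx_yz%:R - Fxy%:R) / p%:R)%R =
    (((Fyz + Fx_yz)%:R / p%:R) - ((Fxyz + Fxy)%:R / p%:R))%R :> rat.
  by rewrite -mulrBl !natrD; congr (_ / _)%R; ring.
rewrite -/(qz_eq _ _) qz_natF // !natrD !natr_Zp /Fyz /Fxyz /Fx_yz /Fxy /F.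
have [-> -> ->] := coordsM _ _ xG yG; have [-> -> ->] := coordsM _ _ yG zG.
by apply/eqP; ring.
Qed.

(* Splitting [g (x * y) = g (y * x * [~ x, y])] in two ways determines [g] on commutators. *)
Let coboundary_commg (g : gT -> rat) x y :
  (forall x y, x \in G -> y \in G -> qz_eq (f x y) (g x + g y - g (x * y)%g)%R) ->
  x \in G -> y \in G ->
  qz_eq (g [~ x, y]) (f y x + f (y * x)%g [~ x, y] - f x y)%R.
Proof.
move=> fg xG yG; have cG : [~ x, y] \in G by rewrite groupR.
have := fg x y xG yG; have := fg y x yG xG; have := fg (y * x) _ (groupM yG xG) cG.
rewrite -commgC /qz_eq => i1 i2 i3.
rewrite (_ : (_ - _)%R = (f x y - (g x + g y - g (x * y)%g) - (f y x - (g y + g x - g (y * x)%g))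
   - (f (y * x)%g [~ x, y] - (g (y * x)%g + g [~ x, y] - g (x * y)%g)))%R); last by ring.
by apply: rpredB => //; apply: rpredB.
Qed.

(** If [f] were the coboundary of [g], then modulo integers [g f5] would be 0 when computed from
    [[~ f4, f1]], as [f] vanishes once an argument lies in [N], but [f f2 f3 - f f3 f2] when
    computed from [[~ f3, f2]]. *)
Lemma B0_nontrivial_of_relations : B0_nontrivial G.
Proof.
have [F1 F2 F3 F4 F5] := Gf; have [E1 [E2 [E3 _]]] := phi_gen.
have P2 : psi f2 = (0, 1, 0)%R by apply: psiE.
have P3 : psi f3 = (0, 0, 1)%R by apply: psiE.
exists f; split; first exact: f_cocycle.
  case=> g fg; have := coboundary_commg g f4 f1 fg F4 F1; have := coboundary_commg g f3 f2 fg F3 F2.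
  have [f41 f14] := FN f4 f1 f4N; have f5r y := (FN f5 y f5N).2.
  rewrite r41 r32 !(f0 _ f5) ?(f0 f4 f1) ?(f0 f1 f4) //.
  rewrite !addr0 /qz_eq !subr0 => i1 i2.
  have : qz_eq (f f2 f3) (f f3 f2).
    by rewrite /qz_eq -[(f f2 f3 - _)%R](subKr (g f5)); exact: rpredB.
  rewrite /f qz_natF // !natr_Zp /F /cC /cA /cB P2 P3 /= -subr_eq0.
  (* Since [cC f3] is 2, [F f2 f3] is -6 and [F f3 f2] is 6. *)
  rewrite (_ : (_ - _)%R = - 12%:R)%R; last by ring.
  by rewrite oppr_eq0; apply/negP/natF_neq0.
move=> A AG bA; have abA : abelian A.
  case: bA => [/cyclic_abelian //|[H [K [cH cK]]]].
  by case/dprodP => _ <- cHK _; rewrite abelianM !cyclic_abelian // centsC.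
exists (fun=> 0%R) => x y xA yA; rewrite /qz_eq.
have [w0 d0] := coords_comm _ _ (subsetP AG x xA) (subsetP AG y yA) (centsP abA x xA y yA).
by rewrite f0 ?subr0 ?addr0 // /F w0 d0 !mulr0 subrr.
Qed.

End Presentation.

(** * Explicit groups of order p^5 *)

(** The parameters tag the type, so that each pair receives its own group structure; [k1] and [k2]
    become the last coordinates of the [p]-th powers of the first two generators. *)
Record nil4 (p : nat) (k1 k2 : 'F_p) := Nil4 {
  n4a : 'F_p; n4b : 'F_p; n4c : 'F_p; n4d : 'F_p; n4e : 'F_p }.
Arguments n4a {p k1 k2}. Arguments n4b {p k1 k2}. Arguments n4e {p k1 k2}.

Section Nil4.
Local Open Scope ring_scope.
Variables (p : nat) (k1 k2 : 'F_p).

(* The cocycle of the extension Z/p^2 of Z/p by Z/p. *)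
Definition carry (x y : 'F_p) : 'F_p := ((val x + val y) %/ (Zp_trunc (pdiv p)).+2)%:R.

Definition tuple_of_nil4 (x : nil4 p k1 k2) :=
  let: Nil4 a b c d e := x in (a, b, c, d, e).
Definition nil4_of_tuple (u : 'F_p * 'F_p * 'F_p * 'F_p * 'F_p) : nil4 p k1 k2 :=
  let: (a, b, c, d, e) := u in Nil4 p k1 k2 a b c d e.
Lemma tuple_of_nil4K : cancel tuple_of_nil4 nil4_of_tuple.
Proof. by case. Qed.
HB.instance Definition _ := Finite.copy (nil4 p k1 k2) (can_type tuple_of_nil4K).

(* The Baker-Campbell-Hausdorff product in a nilpotent Lie ring of class 4: writing {x, y} for
   [x, y] / 2, it is x + y + {x, y} + {x - y, {x, y}} / 3 - {y, {x, {x, y}}} / 3. The basis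
   x1, ..., x5 is scaled to avoid denominators: {x2, x1} = x3, {x3, x1} = 3 x4, {x4, x1} = x5 and
   {x3, x2} = 6 x5. *)
Definition nil4_mul (x y : nil4 p k1 k2) : nil4 p k1 k2 :=
  let: Nil4 a b c d e := x in let: Nil4 a' b' c' d' e' := y in
  let w := b * a' - a * b' in
  let v := c * a' - a * c' in
  Nil4 p k1 k2 (a + a') (b + b') (c + c' + w) (d + d' + 3 * v + (a' - a) * w)
    (e + e' + (d * a' - a * d') + 6 * (c * b' - b * c') + (a' - a) * v
      + 2 * (b' - b) * w - a * a' * w + k1 * carry a a' + k2 * carry b b').
Definition nil4_one : nil4 p k1 k2 := Nil4 p k1 k2 0 0 0 0 0.
Definition nil4_inv (x : nil4 p k1 k2) :=
  let: Nil4 a b c d e := x in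
  Nil4 p k1 k2 (- a) (- b) (- c) (- d) (- e - k1 * carry a (- a) - k2 * carry b (- b)).

Lemma carryC x y : carry x y = carry y x.
Proof. by rewrite /carry addnC. Qed.
Lemma carry0 x : carry 0 x = 0.
Proof. by rewrite /carry /= add0n divn_small. Qed.

(** Both sides are the total carry in adding three digits, the quotient of [x + y + z] by the
    modulus. *)
Lemma carryA x y z : carry x y + carry (x + y) z = carry y z + carry x (y + z).
Proof.
rewrite /carry -!natrD /=; congr (_ %:R).
set P := _.+2; have P0 : (0 < P)%N by [].
have E (u v : nat) : (u %/ P + (u %% P + v) %/ P = (u + v) %/ P)%N.
  by rewrite {3}(divn_eq u P) -addnA divnMDl.
by rewrite E [(x + _ %% _)%N]addnC E -addnA addnC.
Qed.

Lemma nil4_mulA : associative nil4_mul.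
Proof.
case=> [a b c d e] [a' b' c' d' e'] [a'' b'' c'' d'' e''] /=; congr Nil4; try ring.
have Ha := carryA a a' a''; have Hb := carryA b b' b''.
(* Once the cocycle identity has eliminated one carry for each of the first two coordinates,
   associativity is a polynomial identity. *)
have -> : carry a (a' + a'') = carry a a' + carry (a + a') a'' - carry a' a'' by rewrite Ha; ring.
have -> : carry b (b' + b'') = carry b b' + carry (b + b') b'' - carry b' b'' by rewrite Hb; ring.
ring.
Qed.
Lemma nil4_mul1 : left_id nil4_one nil4_mul.
Proof. by case=> a b c d e; rewrite /nil4_mul /= !carry0; congr Nil4; ring. Qed.
Lemma nil4_mulV : left_inverse nil4_one nil4_inv nil4_mul.
Proof. by case=> a b c d e; rewrite /nil4_mul /= ![carry (- _) _]carryC; congr Nil4; ring. Qed.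

HB.instance Definition _ :=
  Finite_isGroup.Build (nil4 p k1 k2) nil4_mulA nil4_mul1 nil4_mulV.

Implicit Types x y : nil4 p k1 k2.

Lemma nil4M x y : (x * y)%g = nil4_mul x y. Proof. by []. Qed.

Lemma nil4V x : (x^-1)%g = nil4_inv x. Proof. by []. Qed.

(** Checked as x y = y x [x, y], which avoids inverses. The carries cancel because [carry] is
    symmetric and the commutator is zero in its first two coordinates. *)
Lemma nil4_comm a b c d e a' b' c' d' e' :
  let w := b * a' - a * b' in let v := c * a' - a * c' in
  let D := 6 * v + 6 * (a + a') * w in
  [~ Nil4 p k1 k2 a b c d e, Nil4 p k1 k2 a' b' c' d' e'] =
  Nil4 p k1 k2 0 0 (2 * w) D
    (2 * (d * a' - a * d') + 12 * (c * b' - b * c') - 2 * a * a' * w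
      + (a + a') * D + 12 * (b + b') * w - 2 * (a + a') ^+ 2 * w).
Proof.
move=> w v D; apply: (mulgI (Nil4 p k1 k2 a' b' c' d' e' * Nil4 p k1 k2 a b c d e)%g).
rewrite -commgC !nil4M /= ![carry (_ + _) _]carryC !carry0 [carry a' a]carryC [carry b' b]carryC.
rewrite /D /w /v; congr Nil4; ring.
Qed.

Lemma nil4_comm0 c d e a' b' c' d' e' :
  [~ Nil4 p k1 k2 0 0 c d e, Nil4 p k1 k2 a' b' c' d' e'] =
  Nil4 p k1 k2 0 0 0 (6 * (c * a')) (2 * (d * a') + 12 * (c * b') + 6 * (c * a' ^+ 2)).
Proof. by rewrite nil4_comm; congr Nil4; ring. Qed.

(** Brackets of proportional vectors vanish, so the coordinates scale; the successive carries
    telescope to the quotients. *)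
Lemma nil4_expg a b c d e n :
  (Nil4 p k1 k2 a b c d e ^+ n)%g =
  Nil4 p k1 k2 (a *+ n) (b *+ n) (c *+ n) (d *+ n)
    (e *+ n + k1 * ((n * a) %/ (Zp_trunc (pdiv p)).+2)%:R
            + k2 * ((n * b) %/ (Zp_trunc (pdiv p)).+2)%:R).
Proof.
set P := _.+2.
have carry_muln (u : 'F_p) m : carry (u *+ m) u = ((m.+1 * u) %/ P)%:R - ((m * u) %/ P)%:R.
  rewrite /carry; have -> : val (u *+ m) = ((m * u) %% P)%N.
    by rewrite -[u in LHS]natr_Zp -mulrnA mulnC Zp_nat.
  apply/eqP; rewrite eq_sym subr_eq -natrD; apply/eqP; congr _%:R.
  by rewrite mulSnr {1}(divn_eq (m * u) P) -addnA divnMDl // addnC.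
elim: n => [|n IHn]; first by rewrite expg0 !mul0n !div0n; congr Nil4; rewrite !mulr0 !addr0.
rewrite expgSr IHn nil4M /= !carry_muln ![_ *+ n.+1]mulrSr; congr Nil4; ring.
Qed.

Lemma nil4_expg0 c d e n :
  (Nil4 p k1 k2 0 0 c d e ^+ n)%g = Nil4 p k1 k2 0 0 (c *+ n) (d *+ n) (e *+ n).
Proof. by rewrite nil4_expg /= !muln0 !div0n !mulr0 !addr0 !mul0rn. Qed.

Lemma mulrn_surj (u v : 'F_p) : u != 0 -> exists n : nat, v = u *+ n.
Proof. by move=> u0; exists (v / u : 'F_p); rewrite -mulr_natr natr_Zp mulrC divfK. Qed.

(** Multiples by [p] vanish, and the carry accumulated by [p] copies of a digit is the digit
    itself. *)
Lemma nil4_expgp : prime p -> forall x, (x ^+ p)%g = Nil4 p k1 k2 0 0 0 0 (k1 * n4a x + k2 * n4b x).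
Proof.
move=> pp [a b c d e]; rewrite nil4_expg !(mulrn_pchar (pchar_Fp pp)) add0r.
have pK m : ((p * m) %/ (Zp_trunc (pdiv p)).+2)%N = m by rewrite Fp_cast // mulKn ?prime_gt0.
by rewrite !pK !natr_Zp.
Qed.

Lemma card_nil4 : prime p -> #|[set: nil4 p k1 k2]| = (p ^ 5)%N.
Proof.
move=> pp; have -> : #|[set: nil4 p k1 k2]| = #|{: 'F_p * 'F_p * 'F_p * 'F_p * 'F_p}|.
  rewrite cardsT; apply: (bij_eq_card (f := tuple_of_nil4)); exists nil4_of_tuple => //.
    exact: tuple_of_nil4K.
  by case=> [[[[]]]].
by rewrite !card_prod !card_Fp // !expnSr expn0 mul1n.
Qed.

Definition nil4_f1 : nil4 p k1 k2 := Nil4 p k1 k2 1 0 0 0 0.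
Definition nil4_f2 : nil4 p k1 k2 := Nil4 p k1 k2 0 1 0 0 0.
(** The coordinates of this and the next two elements are the values of [nil4_comm] on the
    successive commutators with [nil4_f1]. *)
Definition nil4_f3 : nil4 p k1 k2 := Nil4 p k1 k2 0 0 2 6 16.
Definition nil4_f4 : nil4 p k1 k2 := Nil4 p k1 k2 0 0 0 12 24.
Definition nil4_f5 : nil4 p k1 k2 := Nil4 p k1 k2 0 0 0 0 24.

Lemma nil4_relations :
  [/\ [~ nil4_f2, nil4_f1] = nil4_f3, [~ nil4_f3, nil4_f1] = nil4_f4,
      [~ nil4_f4, nil4_f1] = nil4_f5 &
   [/\ [~ nil4_f3, nil4_f2] = nil4_f5, [~ nil4_f4, nil4_f2] = 1%g & [~ nil4_f4, nil4_f3] = 1%g]].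
Proof. by split; [| | |split]; rewrite nil4_comm; congr Nil4; ring. Qed.

Lemma nil4_f5_center : nil4_f5 \in 'Z([set: nil4 p k1 k2]).
Proof.
apply/centerP; split=> [|[a b c d e] _]; first by rewrite inE.
apply/commgP/eqP; rewrite nil4_comm; congr Nil4; ring.
Qed.

(** A triangular argument: working up from the last coordinate, the leading coefficients 24, 12, 2,
    1, 1 of the generators are invertible, so a power of one generator corrects each coordinate. *)
Lemma nil4_gen : prime p -> (5 <= p)%N ->
  [set: nil4 p k1 k2] = <<[set nil4_f1; nil4_f2; nil4_f3; nil4_f4; nil4_f5]>>%g.
Proof.
move=> pp p5; apply/esym/eqP; rewrite eqEsubset subsetT /=; apply/subsetP => x _.
set S := <<_>>%g.
have [F1 F2 F3 F4 F5] :
    [/\ nil4_f1 \in S, nil4_f2 \in S, nil4_f3 \in S, nil4_f4 \in S & nil4_f5 \in S].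
  by split; apply: mem_gen; rewrite !inE eqxx ?orbT.
have pr n := natF_neq0 p n pp p5.
have mul0 c d e c' d' e' : (Nil4 p k1 k2 0 0 c d e * Nil4 p k1 k2 0 0 c' d' e')%g
    = Nil4 p k1 k2 0 0 (c + c') (d + d') (e + e').
  by rewrite nil4M /= !carry0; congr Nil4; ring.
have Se t : Nil4 p k1 k2 0 0 0 0 t \in S.
  have [n ->] := mulrn_surj 24 t (pr 24 isT isT).
  by have := groupX n F5; rewrite nil4_expg0 !mul0rn.
have Sd d e : Nil4 p k1 k2 0 0 0 d e \in S.
  have [n ->] := mulrn_surj 12 d (pr 12 isT isT).
  have := groupM (groupX n F4) (Se (e - 24 *+ n)).
  by rewrite nil4_expg0 mul0 !mul0rn !addr0 [_ + (e - _)]addrC subrK.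
have Sc c d e : Nil4 p k1 k2 0 0 c d e \in S.
  have [n ->] := mulrn_surj 2 c (pr 2 isT isT).
  have := groupM (groupX n F3) (Sd (d - 6 *+ n) (e - 16 *+ n)).
  by rewrite nil4_expg0 mul0 !addr0 [_ + (d - _)]addrC [_ + (e - _)]addrC !subrK.
have Sb y : n4a y = 0 -> y \in S.
  move=> ya; have [n bE] := mulrn_surj 1 (n4b y) (pr 1 isT isT).
  rewrite -(groupMl _ (groupVr (groupX n F2))).
  move: (nil4_expg 0 1 0 0 0 n) bE ya; rewrite -/nil4_f2 => ->; case: y => a b c d e /= -> ->.
  rewrite nil4V nil4M /= mul0rn oppr0 !addr0 addNr; exact: Sc.
have [n aE] := mulrn_surj 1 (n4a x) (pr 1 isT isT).
rewrite -(groupMl _ (groupVr (groupX n F1))); apply: Sb.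
move: (nil4_expg 1 0 0 0 0 n) aE; rewrite -/nil4_f1 => ->; case: x => a b c d e /= ->.
exact: addNr.
Qed.

End Nil4.

(** * Separating the isomorphism types *)

(** Let f1 and f2 map to elements with leading coordinates (a, b) and (a2, b2). The relation
    [f4, f2] = 1 forces a2 = 0, and [f4, f1] = [f3, f2] forces b2 = a^2. The last coordinate of f5
    is then multiplied by a^5, and comparing [p]-th powers of f1 and f2 gives the two equations. *)
Lemma nil4_morphism_params (p : nat) (k1 k2 l1 l2 : 'F_p)
    (h : {morphism [set: nil4 p k1 k2] >-> nil4 p l1 l2}) :
  prime p -> (5 <= p)%N -> 'injm h ->
  exists a b : 'F_p, [/\ a != 0, k1 * a ^+ 5 = l1 * a + l2 * b & k2 * a ^+ 3 = l2]%R.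
Proof.
move=> pp p5 injh.
have [r3 r4 r5 [r5' r42 _]] := nil4_relations p k1 k2.
have hR x y : h [~ x, y] = [~ h x, h y] by rewrite morphR ?inE.
have hX x n : h (x ^+ n) = h x ^+ n by rewrite morphX ?inE.
have pr n := natF_neq0 p n pp p5.
have h5 : h (nil4_f5 p k1 k2) <> 1.
  move=> h51; have E := injmP injh (nil4_f5 p k1 k2) 1 (in_setT _) (in_setT _).
  have /(congr1 n4e) e5 := E (etrans h51 (esym (morph1 h))).
  by have /eqP := pr 24 isT isT.
have hz (t : 'F_p) : exists n, t = (24 *+ n)%R /\
    h (Nil4 p k1 k2 0%R 0%R 0%R 0%R t) = h (nil4_f5 p k1 k2) ^+ n.
  have [n ->] := mulrn_surj p 24%R t (pr 24 isT isT).
  by exists n; rewrite -hX nil4_expg0 !mul0rn.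
have gp := nil4_expgp p l1 l2 pp.
have := gp (h (nil4_f2 p k1 k2)); have := gp (h (nil4_f1 p k1 k2)).
rewrite -!hX !nil4_expgp //=; have [n1 [n1E ->]] := hz (k1 * 1 + k2 * 0)%R.
have [n2 [n2E ->]] := hz (k1 * 0 + k2 * 1)%R.
have := congr1 h r42; have := congr1 h r5'; have := congr1 h r5.
rewrite -r4 -r3 !hR morph1; move: (h (nil4_f5 p k1 k2)) h5 => h5.
case: (h (nil4_f1 p k1 k2)) => a b c d e; case: (h (nil4_f2 p k1 k2)) => a2 b2 c2 d2 e2.
rewrite [[~ Nil4 _ _ _ a2 _ _ _ _, _]]nil4_comm !nil4_comm0.
set w := (b2 * a - a2 * b)%R => h5n1 /esym h5a /esym h5b /(congr1 n4e) /= h42.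
have {}h5a : h5 = Nil4 p l1 l2 0%R 0%R 0%R 0%R (24 * (w * a ^+ 2))%R.
  by rewrite h5a; congr Nil4; ring.
have wa0 : (w * a ^+ 2)%R != 0%R.
  by apply/eqP => wa0; case: h5n1; rewrite h5a wa0 mulr0.
have [w0 a0] : w != 0%R /\ a != 0%R.
  by move: wa0; rewrite mulf_eq0 expf_eq0 negb_or /= => /andP.
have a20 : a2 = 0%R.
  have E : (24 * (w * a) * a2 = 0)%R by rewrite -h42; ring.
  by move/eqP: E; rewrite !mulf_eq0 (negPf w0) (negPf a0) (negPf (pr 24 isT isT)) => /eqP.
have wE : w = (b2 * a)%R by rewrite /w a20; ring.
have b2E : b2 = (a ^+ 2)%R.
  have E : (24 * w * (b2 - a ^+ 2) = 0)%R.
    move: h5b; rewrite h5a => /(congr1 n4e) /= E.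
    have -> : (24 * w * (b2 - a ^+ 2) = 24 * w * b2 - 24 * (w * a ^+ 2))%R by ring.
    by rewrite E a20; ring.
  move/eqP: E; rewrite !mulf_eq0 (negPf w0) (negPf (pr 24 isT isT)) subr_eq0 => /eqP //.
rewrite h5a !nil4_expg0 => /(congr1 n4e) /= F1 /(congr1 n4e) /= F2.
exists a, b; split => //.
  rewrite -F1 wE b2E -[k1]mulr1 -[(k1 * 1)%R]addr0 -[X in (_ + X)%R](mulr0 k2) n1E -!mulrnAl; ring.
have a2n0 : (a ^+ 2)%R != 0%R by rewrite expf_eq0.
apply: (mulIf a2n0); rewrite -[in RHS]b2E -[RHS]add0r -[X in (X + _)%R](mulr0 l1).
rewrite -[X in (_ * X + _)%R]a20 -F2.
rewrite wE b2E -[k2]mulr1 -[(k2 * 1)%R]add0r -[X in (X + _)%R](mulr0 k1) n2E -!mulrnAl; ring.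
Qed.

Lemma nil4_B0_nontrivial (p : nat) (k1 k2 : 'F_p) : prime p -> (5 <= p)%N ->
  B0_nontrivial [set: nil4 p k1 k2].
Proof.
move=> pp p5; have [r21 r31 r41 [r32 r42 r43]] := nil4_relations p k1 k2.
have in_f5 t : Nil4 p k1 k2 0%R 0%R 0%R 0%R t \in <[nil4_f5 p k1 k2]>.
  have [n ->] := mulrn_surj p 24%R t (natF_neq0 _ 24 pp p5 isT isT).
  by apply/cycleP; exists n; rewrite nil4_expg0 !mul0rn.
have fp := nil4_expgp p k1 k2 pp.
have fp1 (x : nil4 p k1 k2) : n4a x = 0%R -> n4b x = 0%R -> x ^+ p = 1.
  by rewrite fp => -> ->; rewrite !mulr0 addr0.
apply: (B0_nontrivial_of_relations p _ _ _ _ _ _ _ pp p5 (card_nil4 _ _ _ pp) (nil4_gen _ _ _ pp p5)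
  (nil4_f5_center _ _ _) r21 r31 r41 r32 r42 r43).
- by rewrite fp.
- by rewrite fp.
- exact: fp1.
- exact: fp1.
- exact: fp1.
Qed.

(** Raising to the power q = (p - 1) / g, with g the gcd, removes a^m, because p - 1 divides m q.
    The exponents r q and s q of [alpha] that remain differ by less than p - 1, so primitivity makes
    them equal. *)
Lemma prim_root_pow_inj (p alpha m r s : nat) (a : 'F_p) :
  prime p -> prim_root_mod p alpha -> (a != 0)%R ->
  (r < gcdn m p.-1)%N -> (s < gcdn m p.-1)%N ->
  (alpha%:R ^+ r * a ^+ m = alpha%:R ^+ s :> 'F_p)%R -> r = s.
Proof.
move=> pp /andP[co /forallP prim] a0 rg sg E; set g := gcdn m p.-1 in rg sg.
have p0 : (0 < p.-1)%N by rewrite -subn1 subn_gt0 prime_gt1.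
have g0 : (0 < g)%N by rewrite gcdn_gt0 p0 orbT.
have al0 : (alpha%:R != 0 :> 'F_p)%R.
  by rewrite -(dvdn_pcharf (pchar_Fp pp)) -prime_coprime // coprime_sym.
have a1 : (a ^+ p.-1 = 1)%R.
  apply: (mulfI a0); rewrite -exprS prednK ?prime_gt0 // mulr1.
  rewrite -(natr_Zp a) -natrX; apply/eqP.
  by rewrite natF_eqP //; apply/eqP/fermat_little.
pose q := (p.-1 %/ g)%N.
have qE : (q * g = p.-1)%N by rewrite divnK // dvdn_gcdr.
have q0 : (0 < q)%N by rewrite divn_gt0 // dvdn_leq // dvdn_gcdr.
have {}E : (alpha%:R ^+ (r * q) = alpha%:R ^+ (s * q) :> 'F_p)%R.
  have mE : (m * q = p.-1 * (m %/ g))%N.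
    by rewrite -{1}(divnK (dvdn_gcdl m p.-1)) -mulnA [(_ * q)%N]mulnC qE mulnC.
  by rewrite !exprM -E exprMn -[(a ^+ m ^+ q)%R]exprM mE exprM a1 expr1n mulr1.
have main i j : (i < j)%N -> (j < g)%N -> (alpha%:R ^+ (i * q) != alpha%:R ^+ (j * q) :> 'F_p)%R.
  move=> ij jg; apply/eqP => Eij.
  have k_lt : ((j - i) * q < p.-1)%N.
    by rewrite -qE mulnC ltn_pmul2l // (leq_ltn_trans (leq_subr i j)).
  have := prim (Ordinal k_lt); rewrite /= muln_gt0 subn_gt0 ij q0 /= -natF_eqP // natrX
    => /eqP; apply.
  apply: (mulfI (expf_neq0 (i * q) al0)).
  by rewrite -exprD -mulnDl subnKC 1?ltnW // mulr1 -Eij.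
case: (ltngtP r s) => // [rs|sr].
  by have := main r s rs sg; rewrite E eqxx.
by have := main s r sr rg; rewrite E eqxx.
Qed.

Theorem theorem4p5 (p alpha : nat) :
  prime p -> (5 <= p)%N ->
  (0 < alpha)%N -> prim_root_mod p alpha ->
  (forall b : nat, (0 < b < alpha)%N -> ~~ prim_root_mod p b) ->
  let c2 := (gcdn 4 p.-1).-1 in
  let c3 := (gcdn 3 p.-1).-1 in
  (forall (gT : finGroupType) (G : {group gT}) (f1 f2 f3 f4 f5 : gT),
     #|G| = (p ^ 5)%N ->
     G :=: <<[set f1; f2; f3; f4; f5]>> ->
     f5 \in 'Z(G) ->
     [~ f2, f1] = f3 -> [~ f3, f1] = f4 -> [~ f4, f1] = f5 -> [~ f3, f2] = f5 ->
     [~ f4, f2] = 1 -> [~ f4, f3] = 1 ->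
     [\/ [/\ f1 ^+ p = 1, f2 ^+ p = 1, f3 ^+ p = 1, f4 ^+ p = 1 & f5 ^+ p = 1],
         exists2 r : nat, (r <= c2)%N &
           [/\ f1 ^+ p = f5 ^+ (alpha ^ r), f2 ^+ p = 1, f3 ^+ p = 1, f4 ^+ p = 1 & f5 ^+ p = 1]
       | exists2 r : nat, (r <= c3)%N &
           [/\ f2 ^+ p = f5 ^+ (alpha ^ r), f1 ^+ p = 1, f3 ^+ p = 1, f4 ^+ p = 1 & f5 ^+ p = 1]] ->
     B0_nontrivial G)
  /\
  (exists (T : 'I_(1 + gcdn 4 p.-1 + gcdn 3 p.-1) -> finGroupType)
          (H : forall i, {group T i}),
     (forall i, #|H i| = (p ^ 5)%N /\ B0_nontrivial (H i)) /\
     (forall i j, i != j -> ~~ (H i \isog H j))).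
Proof.
move=> pp p5 al0 prim _ c2 c3; split.
  move=> gT G f1 f2 f3 f4 f5 oG genG Zf5 r21 r31 r41 r32 r42 r43 powers.
  have [f1p f2p [f3p f4p f5p]] : [/\ f1 ^+ p \in <[f5]>, f2 ^+ p \in <[f5]> &
      [/\ f3 ^+ p = 1, f4 ^+ p = 1 & f5 ^+ p = 1]].
    case: powers => [[-> -> *]|[r _ [-> -> *]]|[r _ [-> -> *]]];
      by rewrite ?group1 ?groupX ?cycle_id.
  exact: (B0_nontrivial_of_relations p _ _ f1 f2 f3 f4 f5).
set g4 := gcdn 4 p.-1; set g3 := gcdn 3 p.-1.
have alF0 n : (alpha%:R ^+ n != 0 :> 'F_p)%R.
  apply: expf_neq0; case/andP: prim => co _.
  by rewrite -(dvdn_pcharf (pchar_Fp pp)) -prime_coprime // coprime_sym.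
(* Index 0 has both parameters zero. The next [g4] indices form the family with [k1] nonzero, r
   being [i - 1]; the last [g3] form the family with [k2] nonzero, r being [i - g4 - 1]. *)
pose k1 (i : nat) : 'F_p := if (0 < i <= g4)%N then (alpha%:R ^+ i.-1)%R else 0%R.
pose k2 (i : nat) : 'F_p := if (g4 < i)%N then (alpha%:R ^+ (i - g4.+1))%R else 0%R.
exists (fun i => nil4 p (k1 i) (k2 i) : finGroupType), (fun i => [set: nil4 p (k1 i) (k2 i)]%G).
split=> [i|i j]; first by split; [apply: card_nil4 | apply: nil4_B0_nontrivial].
apply: contraNN => /isogP[h injh _].
have [a [b [a0 E1 E2]]] := nil4_morphism_params p _ _ _ _ h pp p5 injh.
apply/eqP/val_inj => /=; move: E1 E2 (ltn_ord i) (ltn_ord j); rewrite -/g4 -/g3 {h injh}.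
move: (nat_of_ord i) (nat_of_ord j) => {i j} i j; rewrite /k1 /k2.
have an0 n : (a ^+ n != 0)%R by apply: expf_neq0.
(* The equation for [k2] separates the last family from the other indices, and distinguishes its
   members up to cubes. *)
have [gi|ig] := ltnP g4 i; have [gj|jg] := ltnP g4 j; rewrite ?andbT ?andbF.
- move=> _ E i_lt j_lt; have lt k : (k < 1 + g4 + g3)%N -> (g4 < k)%N -> (k - g4.+1 < g3)%N.
    by move=> k_lt gk; rewrite ltn_subLR.
  have := prim_root_pow_inj _ _ _ _ _ _ pp prim a0 (lt _ i_lt gi) (lt _ j_lt gj) E.
  by move/(congr1 (addn^~ g4.+1)); rewrite !subnK.
- by move=> _ /eqP; rewrite mulf_eq0 (negPf (alF0 _)) (negPf (an0 _)).
- by move=> _ /esym/eqP; rewrite mul0r (negPf (alF0 _)).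
(* With both [k2] zero, the first equation has the form k1 a^5 = l1 a. It isolates index 0 and,
   after cancelling [a], compares the others up to fourth powers. *)
case: i ig => [|i] ig; case: j jg => [|j] jg //=; rewrite !mul0r !addr0.
- by move=> /esym/eqP; rewrite mulf_eq0 (negPf (alF0 _)) (negPf a0).
- by move=> /eqP; rewrite mulf_eq0 (negPf (alF0 _)) (negPf (an0 _)).
move=> E _ _ _; congr _.+1; apply: (prim_root_pow_inj p alpha 4 i j a) => //.
by apply: (mulIf a0); rewrite -mulrA -exprSr.
Qed.
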